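(* Let $\dot G=(G,\sigma)$ be a connected unbalanced signed graph of order $n$ with $e(\dot G)$ edges. If $\dot G$ is $C_3^-$-free, then $e(\dot G)\le \frac{n(n-1)}{2}-(n-2)$, with equality if and only if $\dot G\sim \dot G^{s,t}$ for some integers $s,t\ge1$ with $s+t=n-2$. Moreover, for any $s,t\ge 1$ with $s+t=n-2$ and any signed graph $\Gamma$ switching equivalent to $\dot G^{s,t}$ (on the same underlying graph), the number $e^-(\Gamma)$ of negative edges satisfies $e^-(\Gamma)\le \lfloor\frac{n-2}{2}\rfloor\lceil\frac{n-2}{2}\rceil+n-2$, with equality if and only if $\{s,t\}=\{\lfloor\frac{n-2}{2}\rfloor,\lceil\frac{n-2}{2}\rceil\}$ and $\Gamma$ is obtained from $\dot G^{s,t}$ by switching at the vertex set $U=\{v,u_1,\dots,u_s\}$.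
   Context: A signed graph $\dot G=(G,\sigma)$ is a simple graph $G$ with a sign function $\sigma:E(G)\to\{+1,-1\}$. The sign of a cycle is the product of its edge signs; $\dot G$ is balanced if every cycle has sign $+1$ and unbalanced otherwise. $\dot G$ is $C_3^-$-free if it contains no triangle of sign $-1$. For $U\subseteq V(G)$, switching at $U$ reverses the sign of every edge between $U$ and $V(G)\setminus U$; two signed graphs are switching equivalent ($\sim$) if one is obtained from the other by a switching (up to isomorphism). For integers $s,t\ge1$ with $s+t=n-2$, $\dot G^{s,t}$ is the signed graph obtained from the all-positive complete graph on vertices $u_1,\dots,u_s,v_1,\dots,v_t$ and two further vertices $u,v$ by adding the negative edge $uv$ and the positive edges $uu_1,\dots,uu_s,vv_1,\dots,vv_t$.
   Formalization: The last equality case is false as stated for n = 5 (switch G^{1,2} at {u_1,v_1}), so for n = 5 only the bound and the ''if'' direction are proved; for n = 4 it is proved with Γ isomorphic to the switching at U, and for n ≥ 6 literally. *)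

(* Defs.v *)
From HB Require Import structures.
From mathcomp Require Import all_boot all_order all_algebra.

Set Implicit Arguments.
Unset Strict Implicit.
Unset Printing Implicit Defensive.

Import GRing.Theory.

Section SignedGraph.

Variable V : finType.

(* Edges are 2-element vertex sets; the sign function E -> {+1, -1} is given by
   the set of edges on which it takes the value -1 (see [sigma]), so that
   Leibniz equality of signed graphs is equality of graphs and of signs. *)
Record signed_graph := SignedGraph {
  edges : {set {set V}};
  neg_edges : {set {set V}};
  edges_card2 : [forall e in edges, #|e| == 2];
  neg_edges_sub : neg_edges \subset edges
}.

Definition num_edges (G : signed_graph) : nat := #|edges G|.
Definition num_neg_edges (G : signed_graph) : nat := #|neg_edges G|.

Definition sigma (G : signed_graph) (e : {set V}) : int :=
  if e \in neg_edges G then (-1)%R else 1%R.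

Definition adj (G : signed_graph) : rel V :=
  [rel x y | [set x; y] \in edges G].

Definition connected (G : signed_graph) : Prop :=
  forall x y : V, connect (adj G) x y.

Definition is_cycle (G : signed_graph) (c : seq V) : bool :=
  [&& 2 < size c, uniq c & cycle (adj G) c].

Definition cycle_sign (G : signed_graph) (c : seq V) : int :=
  (\prod_(x <- c) sigma G [set x; next c x])%R.

Definition balanced (G : signed_graph) : Prop :=
  forall c : seq V, is_cycle G c -> cycle_sign G c = 1%R.

Definition unbalanced (G : signed_graph) : Prop := ~ balanced G.

Definition C3neg_free (G : signed_graph) : Prop :=
  ~ exists c : seq V,
      [/\ is_cycle G c, size c = 3 & cycle_sign G c = (-1)%R].

Definition crosses (U e : {set V}) : bool := #|e :&: U| == 1.

Definition switch_neg (U : {set V}) (G : signed_graph) : {set {set V}} :=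
  [set e in edges G | (e \in neg_edges G) (+) crosses U e].

Lemma switch_neg_sub U G : switch_neg U G \subset edges G.
Proof. by apply/subsetP=> e; rewrite inE => /andP[]. Qed.

Definition switch (U : {set V}) (G : signed_graph) : signed_graph :=
  SignedGraph (edges_card2 G) (switch_neg_sub U G).

End SignedGraph.

Definition sg_iso (V W : finType) (G : signed_graph V) (H : signed_graph W) :
    Prop :=
  exists f : V -> W,
    [/\ bijective f,
        forall e : {set V}, (f @: e \in edges H) = (e \in edges G)
      & forall e : {set V}, (f @: e \in neg_edges H) = (e \in neg_edges G)].

Definition switching_equivalent (V W : finType)
    (G : signed_graph V) (H : signed_graph W) : Prop :=
  exists U : {set V}, sg_iso (switch U G) H.

Section Gst.

Variables s t : nat.

Definition gst_vertex : finType := ('I_s + 'I_t + bool)%type.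

Definition gst_ui (i : 'I_s) : gst_vertex := inl (inl i).
Definition gst_vj (j : 'I_t) : gst_vertex := inl (inr j).
Definition gst_u : gst_vertex := inr false.
Definition gst_v : gst_vertex := inr true.

Definition gst_us : {set gst_vertex} := [set gst_ui i | i : 'I_s].
Definition gst_vs : {set gst_vertex} := [set gst_vj j | j : 'I_t].

Definition gst_edges : {set {set gst_vertex}} :=
  [set e : {set gst_vertex} | (#|e| == 2) && (e \subset gst_us :|: gst_vs)]
  :|: [set [set gst_u; x] | x in gst_us]
  :|: [set [set gst_v; y] | y in gst_vs]
  :|: [set [set gst_u; gst_v]].

Definition gst_neg_edges : {set {set gst_vertex}} := [set [set gst_u; gst_v]].

Lemma gst_edges_card2 : [forall e in gst_edges, #|e| == 2].
Proof.
apply/forall_inP => e; rewrite !inE -!orbA => /or4P[/andP[]//| | |].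
- by case/imsetP=> x /imsetP[i _ ->] ->; rewrite cards2.
- by case/imsetP=> x /imsetP[i _ ->] ->; rewrite cards2.
- by move/eqP->; rewrite cards2.
Qed.

Lemma gst_neg_edges_sub : gst_neg_edges \subset gst_edges.
Proof. exact: subsetUr. Qed.

Definition Gst : signed_graph gst_vertex :=
  SignedGraph gst_edges_card2 gst_neg_edges_sub.

(* The signed graph obtained from [Gst] by switching at {v, u_1, ..., u_s}. *)
Definition Gst_switched : signed_graph gst_vertex :=
  switch (gst_v |: gst_us) Gst.

End Gst.

(* Main.v *)
(** A shortest negative closed walk is an induced cycle C, and it has length at
    least 4 because triangles are positive.  A vertex joined to all of C would
    write C as a sum of positive triangles, so every vertex off C misses a vertex
    of C; charging to each vertex a non-edge at it (on C, the one to the second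
    next vertex) yields n non-edges if C has length at least 5, and n - 2 if C is
    a 4-cycle.  In the extremal case the vertices off C form a clique and each
    misses exactly one vertex of C; no two of them miss opposite vertices, hence
    an edge uv of C is left over whose ends partition the remaining clique into
    neighbourhoods.  Positive triangles then determine all signs up to switching,
    except that of uv.

    For the number of negative edges, write a graph in the switching class as the
    switching of Gst at a set U avoiding u which contains k of the s + t = m clique
    vertices.  If v is not in U there are k(m - k) + k + 1 negative edges, and if
    v is in U there are at most k(m - k) + m, with equality only if U contains
    every u_i and no v_j. *)

From Stdlib Require Import Classical.
Require Import Defs.
From HB Require Import structures.
From mathcomp Require Import all_boot all_order all_algebra zify.

Set Implicit Arguments.
Unset Strict Implicit.
Unset Printing Implicit Defensive.

Import GRing.Theory.

(** * Two-element sets and the edges of a cut *)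

Lemma eq_set2 (T : finType) (x y a b : T) :
  ([set x; y] == [set a; b]) = (x == a) && (y == b) || (x == b) && (y == a).
Proof.
apply/eqP/idP => [/setP E|]; last first.
  by case/orP=> /andP[/eqP-> /eqP->]; rewrite // setUC.
move: (E x) (E y) (E a) (E b); rewrite !inE !eqxx /= !orbT.
rewrite (eq_sym a x) (eq_sym a y) (eq_sym b x) (eq_sym b y).
by do 4!case: (_ == _).
Qed.

Lemma crosses2 (T : finType) (U : {set T}) x y :
  x != y -> crosses U [set x; y] = (x \in U) (+) (y \in U).
Proof.
move=> xy; rewrite /crosses setIUl.
have I z : [set z] :&: U = if z \in U then [set z] else set0.
  apply/setP=> w; rewrite !inE; case: ifP; rewrite ?inE; case: eqP => // ->.
    by move->.
  by move->.
rewrite !I; case: ifP; case: ifP; rewrite ?set0U ?setU0 ?cards1 ?cards0 //.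
by rewrite cards2 xy.
Qed.

(** Membership in [U] tells the two ends of a crossing pair apart, so such pairs biject with the
    product of [K :&: U] and [K :\: U]. *)
Lemma card_cut (T : finType) (K U : {set T}) :
  #|[set e : {set T} | [&& #|e| == 2, e \subset K & crosses U e]]|
    = #|K :&: U| * #|K :\: U|.
Proof.
rewrite -cardsX -(@card_in_imset _ _ (fun z => [set z.1; z.2])).
  apply: eq_card => e; rewrite inE; apply/idP/imsetP.
    case/and3P=> /cards2P[x [y [xy ->]]] /subsetP sK; rewrite crosses2 //.
    have := sK x; have := sK y; rewrite !inE !eqxx orbT.
    move=> /(_ isT) yK /(_ isT) xK.
    case: (boolP (x \in U)) => xU; case: (boolP (y \in U)) => yU // _.
      by exists (x, y); rewrite // !inE /= xK xU yK yU.
    by exists (y, x); rewrite /= 1?setUC // !inE xK yK xU yU.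
  case=> -[x y]; rewrite !inE /= => /andP[/andP[xK xU] /andP[yU yK]] ->.
  have xy : x != y by apply: contraNneq yU => <-.
  by rewrite cards2 xy subUset !sub1set xK yK crosses2 // xU (negbTE yU).
case=> x y [x' y']; rewrite !inE /= => /andP[/andP[_ xU] /andP[yU _]].
move=> /andP[/andP[_ xU'] /andP[yU' _]] /eqP; rewrite eq_set2.
case/orP=> /andP[/eqP ex /eqP ey]; first by rewrite ex ey.
by rewrite ex (negbTE yU') in xU.
Qed.

(** * Signs of closed walks, potentials and switching *)

Section SignedGraphTheory.

Variables (V : finType).
Implicit Type G : signed_graph V.

Definition neg G (x y : V) : bool := [set x; y] \in neg_edges G.

Lemma adjC G x y : adj G x y = adj G y x.
Proof. by rewrite /adj /= setUC. Qed.

Lemma negC G x y : neg G x y = neg G y x.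
Proof. by rewrite /neg setUC. Qed.

Lemma card_edge G e : e \in edges G -> #|e| = 2.
Proof. by move=> eG; apply/eqP; move/forall_inP: (edges_card2 G); apply. Qed.

Lemma adj_neq G x y : adj G x y -> x != y.
Proof. by move/card_edge; rewrite cards2; case: eqP. Qed.

Lemma adjxx G x : adj G x x = false.
Proof. by apply/negP => /adj_neq; rewrite eqxx. Qed.

Lemma neg_adj G x y : neg G x y -> adj G x y.
Proof. exact: (subsetP (neg_edges_sub G)). Qed.

Lemma negxx G x : neg G x x = false.
Proof. by apply/negP => /neg_adj; rewrite adjxx. Qed.

Lemma signed_graph_eq G H :
  edges G = edges H -> neg_edges G = neg_edges H -> G = H.
Proof.
case: G H => [E N p q] [E' N' p' q'] /= EE NN; subst E' N'.
by rewrite (bool_irrelevance p p') (bool_irrelevance q q').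
Qed.

Lemma signed_graph_pair_eq G H :
  edges G = edges H -> (forall x y, adj G x y -> neg G x y = neg H x y) -> G = H.
Proof.
move=> EE NN; apply: signed_graph_eq => //; apply/setP => e.
case eG: (e \in edges G).
  have /eqP/cards2P[x [y [_ exy]]] := card_edge eG.
  by rewrite exy; apply: NN; rewrite /adj /= -exy.
have /negbTE-> : e \notin neg_edges G.
  by apply: contraFN eG; apply/subsetP/neg_edges_sub.
by apply/esym/(contraFF _ eG); rewrite EE; apply/subsetP/neg_edges_sub.
Qed.

Lemma neg_switch U G x y :
  neg (switch U G) x y = adj G x y && (neg G x y (+) (x \in U) (+) (y \in U)).
Proof.
rewrite /neg inE /adj /=; case E: (_ \in edges G) => //=.
by rewrite crosses2 ?addbA //; apply: (@adj_neq G).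
Qed.

(** An edge crosses [U] exactly when it crosses the complement; this later allows u to be assumed
    outside the switching set. *)
Lemma switch_setC U G : switch (~: U) G = switch U G.
Proof.
apply: signed_graph_pair_eq => // x y xy; rewrite !neg_switch !inE.
by do 2!case: (_ \in U); case: (neg _ _ _).
Qed.

Definition triangle_positive G :=
  forall x y z, adj G x y -> adj G y z -> adj G z x ->
    neg G x y (+) neg G y z (+) neg G z x = false.

(** By Harary's criterion a potential amounts to balance: switching at [[set x | p x]] makes every
    edge positive. *)
Definition potential G (p : V -> bool) :=
  forall x y, adj G x y -> neg G x y = p x (+) p y.

Fixpoint walk_neg G x p : bool :=
  if p is y :: p' then neg G x y (+) walk_neg G y p' else false.

(** Closed walks may repeat vertices, unlike cycles, so cutting one at a chord or at a repeated
    vertex again yields closed walks. The start is listed once, hence [size c] is the length. *)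
Definition negative_walk G c :=
  if c is x :: p then path (adj G) x (rcons p x) && walk_neg G x (rcons p x)
  else false.

Lemma walk_neg_cat G x p q :
  walk_neg G x (p ++ q) = walk_neg G x p (+) walk_neg G (last x p) q.
Proof. by elim: p x => //= y p IH x; rewrite IH addbA. Qed.

Lemma walk_neg_rcons G x p y :
  walk_neg G x (rcons p y) = walk_neg G x p (+) neg G (last x p) y.
Proof. by rewrite -cats1 walk_neg_cat /= addbF. Qed.

Lemma sigmaE G x y : sigma G [set x; y] = ((-1) ^+ neg G x y)%R.
Proof. by rewrite /sigma /neg; case: ifP. Qed.

Lemma cycle_signE G x p : uniq (x :: p) ->
  cycle_sign G (x :: p) = ((-1) ^+ walk_neg G x (rcons p x))%R.
Proof.
move=> up; rewrite /cycle_sign [next _]/=.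
(* [next_at] carries the first vertex [y0] along as the successor of the last one; the induction
   keeps it fixed while the head [y] advances. *)
suff: forall y y0, uniq (y :: p) ->
  (\prod_(z <- y :: p) sigma G [set z; next_at z y0 y p])%R =
  ((-1) ^+ walk_neg G y (rcons p y0))%R by apply.
elim: p {up x} => [|z p IH] y y0.
  by move=> _; rewrite big_seq1 /= eqxx sigmaE addbF.
move=> /andP[yp up]; rewrite big_cons /= eqxx sigmaE signr_addb.
congr (_ * _)%R; rewrite -IH //.
by apply: eq_big_seq => w wp; case: eqP => // wy; rewrite wy (negbTE yp) in wp.
Qed.

Lemma C3neg_free_triangle_positive G : C3neg_free G -> triangle_positive G.
Proof.
move=> free x y z xy yz zx; apply/negbTE/negP => N; apply: free.
have uc : uniq [:: x; y; z].
  by rewrite /= !inE negb_or (adj_neq xy) (adj_neq yz) eq_sym (adj_neq zx).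
exists [:: x; y; z]; split=> //; first by rewrite /is_cycle uc /= xy yz zx.
by rewrite cycle_signE //= addbF addbA N expr1.
Qed.

Lemma unbalanced_negative_walk G : unbalanced G -> exists c, negative_walk G c.
Proof.
move=> ub; have [c cN] := not_all_ex_not _ _ ub.
have [/and3P[sc uc cc] sg] := imply_to_and _ _ cN; move: sc uc cc sg {cN}.
case: c => // x p _ up /= cp sg; exists (x :: p); rewrite /= cp /=.
by apply/negPn/negP => /negbTE N; apply: sg; rewrite cycle_signE // N.
Qed.

(** The values telescope along a walk and cancel around a closed one, so a negative closed walk
    excludes potentials. *)
Lemma potential_walk G f x p :
  potential G f -> path (adj G) x p -> walk_neg G x p = f x (+) f (last x p).
Proof.
move=> pf; elim: p x => [|y p IH] x /=; first by rewrite addbb.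
by case/andP=> xy yp; rewrite IH // pf // addbA addbK.
Qed.

Lemma negative_walk_no_potential G c f : negative_walk G c -> ~ potential G f.
Proof.
case: c => // x p /andP[pc nc] pf; move: nc.
by rewrite (potential_walk pf pc) last_rcons addbb.
Qed.

(** * Shortest negative closed walks *)

Definition shortest_negative_walk G c :=
  negative_walk G c /\ forall c', negative_walk G c' -> size c <= size c'.

Lemma shortest_negative_walk_exists G c0 :
  negative_walk G c0 -> exists c, shortest_negative_walk G c.
Proof.
move=> n0; pose P k := [exists c : k.-tuple V, negative_walk G c].
have exP : exists k, P k.
  by exists (size c0); apply/existsP; exists (in_tuple c0).
case: (ex_minnP exP) => k /existsP[c nc] minc; exists c; split=> // c' nc'.
by rewrite size_tuple; apply: minc; apply/existsP; exists (in_tuple c').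
Qed.

Lemma negative_walk_rot G x p y q :
  negative_walk G (x :: p ++ y :: q) -> negative_walk G (y :: q ++ x :: p).
Proof.
rewrite /= !rcons_cat !cat_path /= !rcons_path => /andP[/and4P[-> -> -> ->]].
by rewrite !walk_neg_cat /= !walk_neg_rcons addbA addbC -addbA.
Qed.

Lemma shortest_negative_walk_rot G n c :
  shortest_negative_walk G c -> shortest_negative_walk G (rot n c).
Proof.
case=> nc minc; split=> [|c' /minc]; last by rewrite size_rot.
have := nc; rewrite /rot -{1}(cat_take_drop n c).
case: (take n c) => [|x p]; first by rewrite cats0.
case: (drop n c) => [|y q]; first by rewrite cats0.
exact: negative_walk_rot.
Qed.

(** Each of the two closed walks cut off by the chord traverses it once, so their signs multiply to
    the sign of the whole walk. *)
Lemma negative_walk_chord G x p y q : adj G x y ->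
  negative_walk G (x :: p ++ y :: q) ->
  negative_walk G (x :: rcons p y) || negative_walk G (y :: rcons q x).
Proof.
move=> xy; rewrite /= !rcons_cat !cat_path /= !rcons_path !last_rcons.
rewrite !walk_neg_cat /= !walk_neg_rcons !last_rcons xy (adjC G y x) xy.
case/andP=> /and4P[-> -> -> ->] /=; rewrite (negC G y x).
by do 4!case: (walk_neg _ _ _); do 3!case: (neg _ _ _).
Qed.

Lemma shortest_negative_walk_notin G x p :
  shortest_negative_walk G (x :: p) -> x \notin p.
Proof.
case=> nc minc; apply/negP => xp; case/splitPr: xp nc minc => p1 p2 nc minc.
have: negative_walk G (x :: p1) || negative_walk G (x :: p2).
  move: nc; rewrite /= rcons_cat cat_path /= !rcons_path.
  rewrite walk_neg_cat /= !walk_neg_rcons.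
  by case/andP=> /and4P[-> -> -> ->] /=; rewrite addbA; case: (walk_neg _ x p1 (+) _).
by case/orP=> /minc; rewrite /= size_cat /=; lia.
Qed.

Lemma shortest_negative_walk_uniq G c : shortest_negative_walk G c -> uniq c.
Proof.
move=> sc; suff U p1 p2 : c = p1 ++ p2 -> uniq p2 by exact: (U [::]).
elim: p2 p1 => // x p2 IH p1 cE /=; apply/andP; split; last first.
  by apply: (IH (rcons p1 x)); rewrite cat_rcons.
have := shortest_negative_walk_rot (size p1) sc; rewrite cE rot_size_cat /=.
by move/shortest_negative_walk_notin; rewrite mem_cat negb_or => /andP[].
Qed.

(** A closed walk of length 1 needs a loop, one of length 2 uses an edge twice, and one of length 3
    is a positive triangle. *)
Lemma shortest_negative_walk_size G c : triangle_positive G ->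
  shortest_negative_walk G c -> 3 < size c.
Proof.
move=> tp [nc _]; case: c nc => [|x [|y [|z [|w p]]]] //=.
- by rewrite adjxx.
- by rewrite (negC G y x) addbF addbb andbF.
- case/andP=> /and4P[xy yz zx _].
  by rewrite addbF addbA tp.
Qed.

(** A chord to the second next vertex would cut off two shorter closed walks, one of them negative.
    The last clause fails on a 4-cycle, whence n - 2 instead of n non-edges there. *)
Lemma shortest_negative_walk_next2 G c x : triangle_positive G ->
  shortest_negative_walk G c -> x \in c ->
  let y := next c (next c x) in
  [/\ y \in c, y != x, ~~ adj G x y
    & 4 < size c -> next c (next c y) != x].
Proof.
move=> tp sc xc y; have uc := shortest_negative_walk_uniq sc.
rewrite {}/y !mem_next xc; case: (rot_to xc) => n p rc.
have := shortest_negative_walk_rot n sc.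
rewrite -(size_rot n) -!(next_rot n uc) rc; move: uc; rewrite -(rot_uniq n) rc.
move=> uc sc'; have := shortest_negative_walk_size tp sc'.
case: p uc sc' {rc} => [|a [|b [|d p]]] // uc sc' _.
have nxb : ~~ adj G x b.
  apply/negP => /(@negative_walk_chord G x [:: a] b (d :: p)) /(_ sc'.1).
  by case/orP=> /sc'.2 /=; rewrite ?size_rcons; lia.
have [xa xb xd] : [/\ x != a, x != b & x != d].
  by move: uc; rewrite /= !inE !negb_or => /andP[/and4P[]].
have [ab ad bd] : [/\ a != b, a != d & b != d].
  by move: uc => /=; rewrite !inE !negb_or => /and4P[_ /and3P[-> ->] _ /andP[->]].
have -> : next [:: x, a, b, d & p] x = a by rewrite /= eqxx.
have -> : next [:: x, a, b, d & p] a = b.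
  by rewrite /= eq_sym (negbTE xa) eqxx.
split=> //; first by rewrite eq_sym.
have -> : next [:: x, a, b, d & p] b = d.
  by rewrite /= eq_sym (negbTE xb) eq_sym (negbTE ab) eqxx.
case: p => // e p in uc sc' *; move=> _.
have -> : next [:: x, a, b, d, e & p] d = e.
  rewrite /= eq_sym (negbTE xd) eq_sym (negbTE ad) eq_sym (negbTE bd).
  by rewrite eqxx.
by rewrite eq_sym; move: uc; rewrite /= !inE !negb_or => /andP[/and5P[]].
Qed.

(* If [w] is joined to the whole closed walk, the walk is a sum of positive
   triangles through [w]. *)
Lemma negative_walk_nonadj G c w : triangle_positive G -> negative_walk G c ->
  exists2 z, z \in c & ~~ adj G w z.
Proof.
move=> tp; case: c => // x p nc; apply/hasP; rewrite has_predC.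
apply: contraL nc => /allP aw; rewrite negb_and -implybE; apply/implyP => pc.
suff W y q : path (adj G) y q -> {in y :: q, forall z, adj G w z} ->
    walk_neg G y q = neg G w y (+) neg G w (last y q).
  rewrite W // ?last_rcons ?addbb // => z zc; apply: aw.
  by move: zc; rewrite in_cons mem_rcons inE orbA orbb.
elim: q y {pc aw} => [|z q IH] y /=; first by rewrite addbb.
case/andP=> yz pq aw; rewrite IH // => [|t tq]; last first.
  by apply: aw; rewrite inE tq orbT.
have := tp _ _ _ (aw y (mem_head _ _)) yz; rewrite adjC aw ?inE ?eqxx ?orbT //.
move=> /(_ isT); rewrite (negC G z w).
by do 4!case: (neg _ _ _).
Qed.

End SignedGraphTheory.

(** * Charging non-edges to vertices *)

Section Extremal.

Variables (V : finType) (G : signed_graph V).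

Definition nonedges : {set {set V}} := [set e : {set V} | #|e| == 2] :\: edges G.

Lemma card_nonedges : num_edges G + #|nonedges| = 'C(#|V|, 2).
Proof.
rewrite -card_draws -[RHS](cardsID (edges G)) (setIidPr _) //.
by apply/subsetP => e /card_edge; rewrite inE => ->.
Qed.

Lemma mem_nonedges x y : ([set x; y] \in nonedges) = (x != y) && ~~ adj G x y.
Proof. by rewrite !inE cards2 andbC; case: (x == y). Qed.

(** Two vertices of [D] could be charged the same non-edge only if [h] swapped them, which is
    excluded; when the counts agree, every non-edge is charged. *)
Lemma card_nonedges_ge (D : {set V}) (h : V -> V) :
  {in D, forall w, w != h w /\ ~~ adj G w (h w)} ->
  {in D &, forall w w', w' = h w -> w = h w' -> False} ->
  #|D| <= #|nonedges| /\
  (#|nonedges| <= #|D| -> forall x y, x != y -> ~~ adj G x y ->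
    (x \in D /\ y = h x) \/ (y \in D /\ x = h y)).
Proof.
move=> hN hh; pose N := [set [set w; h w] | w in D].
have cN : #|N| = #|D|.
  apply: card_in_imset => w w' wD wD' /eqP; rewrite eq_set2.
  case/orP=> /andP[/eqP ew /eqP eh] //.
  by case: (hh w w' wD wD').
have sN : N \subset nonedges.
  apply/subsetP => _ /imsetP[w wD ->]; rewrite mem_nonedges.
  by case: (hN w wD) => -> ->.
split; first by rewrite -cN subset_leq_card.
rewrite -cN => le x y xy nxy.
have /eqP EN : N == nonedges by rewrite eqEcard sN.
have : [set x; y] \in N by rewrite EN mem_nonedges xy nxy.
case/imsetP=> w wD /eqP; rewrite eq_set2.
by case/orP=> /andP[/eqP-> /eqP->]; [left | right].
Qed.

(** The extremal configuration around a negative induced 4-cycle: off the cycle, [h] gives the only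
    non-neighbour of a vertex; its values on the cycle are left free. *)
Definition square (h : V -> V) a b c d :=
  [/\ [/\ adj G a b, adj G b c, adj G c d & adj G d a],
      [/\ a != c, b != d, ~~ adj G a c & ~~ adj G b d],
      neg G a b (+) neg G b c (+) neg G c d (+) neg G d a,
      forall w, w \notin [:: a; b; c; d] -> h w \in [:: a; b; c; d]
    & forall w, w \notin [:: a; b; c; d] ->
        ~~ adj G w (h w) /\ forall y, y != w -> y != h w -> adj G w y].

Lemma square_rot h a b c d : square h a b c d -> square h b c d a.
Proof.
have E : [:: b; c; d; a] =i [:: a; b; c; d].
  by move=> x; rewrite -[[:: b; _; _; _]]/(rot 1 [:: a; b; c; d]) mem_rot.
case=> -[ab bc cd da] [ac bd nac nbd] N hin hadj; split.
- by split.
- by split; rewrite // 1?eq_sym 1?adjC.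
- by move: N; do 4!case: (neg _ _ _).
- by move=> w; rewrite !E; apply: hin.
- by move=> w; rewrite !E; apply: hadj.
Qed.

Hypothesis tp : triangle_positive G.

Lemma shortest_negative_walk_miss c : shortest_negative_walk G c ->
  exists h, [/\ forall w, w != h w, forall w, h w \in c,
    forall w, ~~ adj G w (h w) & forall w, w \in c -> h w = next c (next c w)].
Proof.
(* The default [w] is never reached: off the walk [negative_walk_nonadj] supplies a missed
   vertex. *)
move=> sc; pose h w := if w \in c then next c (next c w)
                       else odflt w [pick z in c | ~~ adj G w z].
have hN w : h w \in c /\ ~~ adj G w (h w).
  rewrite /h; case: ifP => wc.
    by case: (shortest_negative_walk_next2 tp sc wc).
  case: pickP => [z /andP[]//|none].
  have [z zc wz] := negative_walk_nonadj w tp sc.1.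
  by have := none z; rewrite zc wz.
exists h; split=> w; try by case: (hN w).
  case: (boolP (w \in c)) => wc; last first.
    by apply: contraNneq wc => ->; case: (hN w).
  rewrite /h wc eq_sym.
  by case: (shortest_negative_walk_next2 tp sc wc).
by rewrite /h => ->.
Qed.

Lemma shortest_negative_walk_nonedges c : shortest_negative_walk G c ->
  #|V| - 2 <= #|nonedges| /\
  (#|nonedges| = #|V| - 2 -> exists h a b c d, square h a b c d).
Proof.
move=> sc; have uc := shortest_negative_walk_uniq sc.
have c4 := shortest_negative_walk_size tp sc.
have [h [hneq hc hN hC]] := shortest_negative_walk_miss sc.
have hP (D : {set V}) : {in D, forall w, w != h w /\ ~~ adj G w (h w)} by [].
have n4 : 4 <= #|V| by rewrite (leq_trans c4) // -(card_uniqP uc) max_card.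
(* For length at least 5 all vertices are charged: two vertices swapped by [h] would lie on the
   walk, and four steps along it would return to the start. This gives n non-edges, so equality with
   n - 2 cannot occur. *)
case: (ltnP 4 (size c)) => [c5|c4'].
  have [|leN _] := card_nonedges_ge (hP [set: V]).
    move=> w w' _ _ ew' ew; have wc : w \in c by rewrite ew.
    have [_ _ _ /(_ c5)] := shortest_negative_walk_next2 tp sc wc.
    by rewrite -(hC w) // -ew' -(hC w') -?ew ?eqxx // ew'.
  by move: leN; rewrite cardsT; split; lia.
case: sc => nc _.
case: c => [|a [|b [|c [|d []]]]] // in uc c4 c4' hc hC nc *.
have [[ab ac ad] [bc bd cd]] :
    [/\ a != b, a != c & a != d] /\ [/\ b != c, b != d & c != d].
  by move: uc; rewrite /= !inE !negb_or => /and4P[/and3P[-> -> ->] /andP[-> ->]].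
have ha : h a = c.
  by rewrite hC ?mem_head //= !eqxx eq_sym (negbTE ab).
have hb : h b = d.
  rewrite hC ?inE ?eqxx ?orbT //= [b == a]eq_sym (negbTE ab) eqxx.
  by rewrite [c == a]eq_sym (negbTE ac) [c == b]eq_sym (negbTE bc) eqxx.
(* On the 4-cycle [a], [c] share one missing diagonal and [b], [d] the other, so [c] and [d] are
   left uncharged. *)
have [|leN eqN] := card_nonedges_ge (hP (~: [set c; d])).
  move=> w w'; rewrite !inE !negb_or => /andP[wc wd] /andP[w'c w'd] ew' ew.
  move: (hc w) (hc w'); rewrite -ew -ew' !inE (negbTE wc) (negbTE wd).
  rewrite (negbTE w'c) (negbTE w'd) !orbF => /orP[]/eqP e' /orP[]/eqP e.
  - by move: (hneq w); rewrite -ew' e e' eqxx.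
  - by move: w'd; rewrite ew' e hb eqxx.
  - by move: w'c; rewrite ew' e ha eqxx.
  - by move: (hneq w); rewrite -ew' e e' eqxx.
have cD : #|~: [set c; d]| = #|V| - 2.
  by rewrite -(cardsC [set c; d]) cards2 cd addKn.
move: leN eqN; rewrite cD => leN eqN; split=> // EN.
have {}eqN := eqN (eq_leq EN); exists h, a, b, c, d.
have hout w : w \notin [:: a; b; c; d] -> forall y, y != w -> y != h w -> adj G w y.
  move=> wc y yw yh; apply/negPn/negP => nwy.
  case: (eqN w y) => [||[_ yE]|[yD wE]] //; first by rewrite eq_sym.
    by rewrite yE eqxx in yh.
  by move: wc; rewrite wE hc.
move: nc => /= /andP[/and5P[aab abc acd ada _] N]; split.
- by split.
- by split; rewrite // -?ha -?hb.
- by move: N; rewrite addbF !addbA.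
- by move=> w _.
- by move=> w wc; split=> //; apply: hout.
Qed.

(* Opposite missed vertices are impossible: the square would be the sum of the
   six positive triangles abw', daw', bcw, cdw, bww' and dww'. *)
Lemma square_opposite h a b c d w w' : square h a b c d ->
  w \notin [:: a; b; c; d] -> w' \notin [:: a; b; c; d] ->
  h w = a -> h w' = c -> False.
Proof.
case=> -[ab bc cd da] [ac bd _ _] N hin hadj wc wc' ew ew'.
have [_ aw] := hadj w wc; have [_ aw'] := hadj w' wc'.
have nba : b != a by rewrite eq_sym (adj_neq ab).
have [ndc nda] : d != c /\ d != a by rewrite eq_sym (adj_neq cd) (adj_neq da).
move: (wc) (wc'); rewrite !inE !negb_or ![w == _]eq_sym ![w' == _]eq_sym.
case/and4P=> wa wb wcc wd /and4P[wa' wb' wcc' wd'].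
have wb1 : adj G w b by apply: aw; rewrite ?ew.
have wc1 : adj G w c by apply: aw; rewrite ?ew // eq_sym.
have wd1 : adj G w d by apply: aw; rewrite ?ew.
have wa2 : adj G w' a by apply: aw'; rewrite ?ew'.
have wb2 : adj G w' b by apply: aw'; rewrite ?ew' // (adj_neq bc).
have wd2 : adj G w' d by apply: aw'; rewrite ?ew'.
have ww : adj G w w'.
  apply: aw; rewrite ?ew; last by rewrite eq_sym.
  by apply: contraNneq ac => ww'; rewrite -ew -ew' ww'.
have t1 := tp wa2 ab; have t2 := tp wd2 da; have t3 := tp wb1 bc.
have t4 := tp wc1 cd; have t5 := tp ww wb2; have t6 := tp ww wd2.
move: N t1 t2 t3 t4 t5 t6.
rewrite ![adj _ _ w]adjC ![adj _ _ w']adjC ![neg _ _ w]negC ![neg _ _ w']negC.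
rewrite wa2 wb2 wb1 wc1 wd1 [neg G w' w]negC.
move=> N /(_ isT) t1 /(_ isT) t2 /(_ isT) t3 /(_ isT) t4 /(_ isT) t5 /(_ isT) t6.
move: N t1 t2 t3 t4 t5 t6.
by do 11!case: (neg _ _ _).
Qed.

End Extremal.

(** * Structure and signs of the extremal graphs *)

Section CliquePair.

Variables (V : finType) (G : signed_graph V).

(* The shape of the underlying graph of Gst, with u, v the ends of the
   negative edge. *)
Definition clique_pair u v :=
  [/\ adj G u v,
      forall x, x \notin [:: u; v] -> adj G v x = ~~ adj G u x,
      forall x y, x \notin [:: u; v] -> y \notin [:: u; v] -> x != y -> adj G x y,
      exists2 p, p \notin [:: u; v] & adj G u p
    & exists2 q, q \notin [:: u; v] & adj G v q].

(** [c] and [d] see every vertex off the cycle, so all vertices except [a] and [b] form a clique.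
    Each of them misses exactly one of [a] and [b]: [c] misses [a], [d] misses [b], and [w] misses
    [h w]. *)
Lemma square_half_clique_pair h a b c d : square G h a b c d ->
  (forall w, w \notin [:: a; b; c; d] -> h w \in [:: a; b]) ->
  clique_pair a b.
Proof.
case=> -[ab bc cd da] [ac bd nac nbd] N hin hadj hab.
have [ca cb] : c != a /\ c != b by rewrite eq_sym ac eq_sym (adj_neq bc).
have [dA db] : d != a /\ d != b by rewrite (adj_neq da) eq_sym bd.
have cases x : x \notin [:: a; b] -> [\/ x = c, x = d | x \notin [:: a; b; c; d]].
  rewrite !inE; case: (x =P a) => //= _; case: (x =P b) => //= _ _.
  case: (x =P c) => [->|_]; first exact: Or31.
  by case: (x =P d) => [->|_]; [exact: Or32|exact: Or33].
have out w : w \notin [:: a; b; c; d] ->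
    [/\ adj G w c, adj G w d & adj G b w = ~~ adj G a w].
  move=> wc; have [nh aw] := hadj w wc; have hw := hab w wc.
  move: (wc); rewrite !inE !negb_or ![w == _]eq_sym => /and4P[wa wb wc' wd].
  have nch z : z \notin [:: a; b] -> z != h w.
    by apply: contraNneq => ->.
  split; try by apply: aw => //; apply: nch; rewrite !inE negb_or ?ca ?cb ?dA ?db.
  rewrite ![adj G _ w]adjC; move: hw; rewrite !inE => /orP[]/eqP ew.
    rewrite -ew (negbTE nh) aw // ew eq_sym; exact: adj_neq ab.
  by rewrite -ew (negbTE nh) aw // ew; exact: adj_neq ab.
split=> //.
- move=> x /cases[->|->|/out[]//]; first by rewrite bc nac.
  by rewrite [adj G a d]adjC da (negbTE nbd).
- move=> x y /cases xE /cases yE.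
  case: xE => [->|->|xc]; case: yE => [->|->|yc] xy //; rewrite ?eqxx // in xy *.
  + by rewrite adjC; case: (out y yc).
  + by rewrite adjC.
  + by rewrite adjC; case: (out y yc).
  + by case: (out x xc).
  + by case: (out x xc).
  have [nh aw] := hadj x xc; apply: aw; first by rewrite eq_sym.
  by apply: contraNneq yc => ->; apply: hin.
- by exists d; rewrite ?inE ?negb_or ?dA ?db // adjC.
- by exists c; rewrite ?inE ?negb_or ?ca ?cb.
Qed.

(** By [square_opposite], one of [a], [c] and one of [b], [d] is missed by no vertex off the cycle.
    The other two are consecutive and become u, v after a rotation. *)
Lemma square_clique_pair h a b c d : triangle_positive G -> square G h a b c d ->
  exists u v, clique_pair u v.
Proof.
move=> tp sq; have sq1 := square_rot sq; have sq2 := square_rot sq1.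
have sq3 := square_rot sq2.
pose W z := [exists w, (w \notin [:: a; b; c; d]) && (h w == z)].
have WP z : reflect (exists2 w, w \notin [:: a; b; c; d] & h w = z) (W z).
  apply: (iffP existsP) => [[w /andP[wc /eqP hw]]|[w wc hw]]; exists w => //.
  by rewrite wc hw eqxx.
have E1 : [:: b; c; d; a] =i [:: a; b; c; d].
  by move=> x; rewrite -[[:: b; _; _; _]]/(rot 1 [:: a; b; c; d]) mem_rot.
have E2 : [:: c; d; a; b] =i [:: a; b; c; d].
  by move=> x; rewrite -[[:: c; _; _; _]]/(rot 2 [:: a; b; c; d]) mem_rot.
have E3 : [:: d; a; b; c] =i [:: a; b; c; d].
  by move=> x; rewrite -[[:: d; _; _; _]]/(rot 3 [:: a; b; c; d]) mem_rot.
have hin : forall w, w \notin [:: a; b; c; d] -> h w \in [:: a; b; c; d].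
  by case: sq.
have ac : ~~ W a \/ ~~ W c.
  case: (boolP (W a)) => [/WP[w wc hw]|_]; [right|by left].
  by apply/WP => -[w' wc' hw']; exact: (square_opposite tp sq wc wc').
have bd : ~~ W b \/ ~~ W d.
  case: (boolP (W b)) => [/WP[w wc hw]|_]; [right|by left].
  apply/WP => -[w' wc' hw'].
  by apply: (square_opposite tp sq1 _ _ hw hw'); rewrite E1.
have half x y z t : ~~ W z -> ~~ W t -> [:: x; y; z; t] =i [:: a; b; c; d] ->
    forall w, w \notin [:: x; y; z; t] -> h w \in [:: x; y].
  move=> Wz Wt E w; rewrite E => wc; have := hin w wc; rewrite -E !inE.
  case: (h w =P z) => [hz|_]; first by case/WP: Wz; exists w.
  case: (h w =P t) => [ht|_]; first by case/WP: Wt; exists w.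
  by rewrite !orbF.
case: ac => [Wa|Wc]; case: bd => [Wb|Wd].
- by exists c, d; apply: (square_half_clique_pair sq2); apply: half.
- by exists b, c; apply: (square_half_clique_pair sq1); apply: half.
- by exists d, a; apply: (square_half_clique_pair sq3); apply: half.
- by exists a, b; apply: (square_half_clique_pair sq); apply: half.
Qed.

(** No triangle contains uv, while positive triangles tie all other edges to a spanning tree. So [f]
    explains every sign except perhaps that of uv, and since [f] is no potential, uv must
    deviate. *)
Lemma clique_pair_switching u v : triangle_positive G -> clique_pair u v ->
  (forall f, ~ potential G f) ->
  exists f : V -> bool, forall x y, adj G x y ->
    neg G x y = f x (+) f y (+) ([set x; y] == [set u; v]).
Proof.
move=> tp [uv ex cl [p pK up] [q qK vq]] np.
have uvN : u != v by exact: adj_neq uv.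
(* [f] is read off a spanning tree: the star at [p] in the clique, the edge from [u] to [p], and the
   edge from [v] to [q], where [q] already has the value [neg G p q]. *)
pose f x := if x == u then neg G u p
            else if x == v then neg G v q (+) neg G p q else neg G p x.
have fK x : x \notin [:: u; v] -> f x = neg G p x.
  by rewrite /f !inE; do 2!case: (x =P _).
have fu : f u = neg G u p by rewrite /f eqxx.
have fv : f v = neg G v q (+) neg G p q by rewrite /f eq_sym (negbTE uvN) eqxx.
have tri z x y : z \notin [:: u; v] -> x \notin [:: u; v] -> y \notin [:: u; v] ->
    neg G x y = neg G z x (+) neg G z y.
  move=> zK xK yK; case: (x =P y) => [->|/eqP xy]; first by rewrite addbb negxx.
  case: (z =P x) => [->|/eqP zx]; first by rewrite negxx.
  case: (z =P y) => [->|/eqP zy]; first by rewrite negxx addbF negC.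
  have := tp _ _ _ (cl _ _ zK xK zx) (cl _ _ xK yK xy); rewrite cl // 1?eq_sym //.
  by move=> /(_ isT); rewrite [neg G y z]negC; do 3!case: (neg _ _ _).
have nbr w z x : z \notin [:: u; v] -> x \notin [:: u; v] ->
    adj G w z -> adj G w x -> neg G w x = neg G w z (+) neg G z x.
  move=> zK xK wz wx; case: (z =P x) => [->|/eqP zx]; first by rewrite negxx addbF.
  have := tp _ _ _ wz (cl _ _ zK xK zx); rewrite adjC wx.
  by move=> /(_ isT); rewrite [neg G x w]negC; do 3!case: (neg _ _ _).
have Eu x : x \notin [:: u; v] -> adj G u x -> neg G u x = f u (+) f x.
  by move=> xK ux; rewrite fu fK //; apply: nbr.
have Ev x : x \notin [:: u; v] -> adj G v x -> neg G v x = f v (+) f x.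
  move=> xK vx; rewrite fv fK // (nbr v q) // (tri p q x) //.
  by rewrite addbA.
have EK x y : x \notin [:: u; v] -> y \notin [:: u; v] -> neg G x y = f x (+) f y.
  by move=> xK yK; rewrite !fK //; apply: tri.
have main x y : adj G x y -> ([set x; y] == [set u; v]) = false ->
    neg G x y = f x (+) f y.
  move=> xy; rewrite eq_set2.
  have xN := adj_neq xy.
  case: (boolP (x \in [:: u; v])); case: (boolP (y \in [:: u; v])).
  - rewrite !inE => /orP[]/eqP yE /orP[]/eqP xE; move: xN; rewrite yE xE ?eqxx //.
    by rewrite orbT.
  - move=> yK; rewrite !inE => /orP[]/eqP xE _; rewrite xE in xy *.
      exact: Eu.
    exact: Ev.
  - rewrite !inE => /orP[]/eqP yE xK _; rewrite yE adjC in xy *.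
      by rewrite negC addbC; apply: Eu => //; rewrite !inE.
    by rewrite negC addbC; apply: Ev => //; rewrite !inE.
  - by move=> yK xK _; apply: EK.
exists f => x y xy; case E: (_ == _); last by rewrite addbF main.
(* If uv also agreed with [f], then [f] would be a potential of the whole graph. *)
case: (boolP (neg G x y == f x (+) f y)) => [/eqP xyE|]; last first.
  by case: (neg _ _ _); case: (f x); case: (f y).
exfalso; apply: (np f) => z t zt; case E': ([set z; t] == [set u; v]); last first.
  exact: main.
move: xyE; rewrite /neg (eqP E) -(eqP E') => ->.
move: E E'; rewrite !eq_set2.
by do 2!case/orP=> /andP[/eqP-> /eqP->]; move=> //; rewrite // addbC.
Qed.

End CliquePair.

(** * Isomorphisms and invariants of switching equivalence *)

Section Isomorphism.

Variables (V W : finType) (G : signed_graph V) (H : signed_graph W).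

Lemma sg_iso_pairs (f : V -> W) : bijective f ->
  (forall x y, adj H (f x) (f y) = adj G x y) ->
  (forall x y, neg H (f x) (f y) = neg G x y) -> sg_iso G H.
Proof.
move=> bf fa fn; exists f; have fi := bij_inj bf.
have E (e : {set V}) (A : {set {set W}}) (B : {set {set V}}) :
    (forall e, e \in A -> #|e| = 2) -> (forall e, e \in B -> #|e| = 2) ->
    (forall x y, ([set f x; f y] \in A) = ([set x; y] \in B)) ->
    (f @: e \in A) = (e \in B).
  move=> A2 B2 AB; case: (boolP (#|e| == 2)) => [/cards2P[x [y [_ ->]]]|/eqP e2].
    by rewrite imsetU1 imset_set1 AB.
  by apply/idP/idP => [/A2|/B2 //]; rewrite card_imset.
have N2 (T : finType) (K : signed_graph T) e : e \in neg_edges K -> #|e| = 2.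
  by move/(subsetP (neg_edges_sub K))/card_edge.
by split=> // e; apply: E => //; [exact: card_edge|exact: card_edge|exact: N2|exact: N2].
Qed.

Lemma sg_iso_card_edges : sg_iso G H -> num_edges G = num_edges H.
Proof.
case=> f [[g fK gK] fe _]; rewrite /num_edges.
rewrite -(card_imset (mem (edges G)) (imset_inj (can_inj fK))).
apply: eq_card => e; apply/imsetP/idP => [[e' ee ->]|ee]; first by rewrite fe.
have eE : e = f @: (g @: e).
  by rewrite -imset_comp (eq_imset _ (gK : f \o g =1 id)) imset_id.
by exists (g @: e); rewrite // -fe -eE.
Qed.

Lemma sg_iso_card_neg_edges : sg_iso G H -> num_neg_edges G = num_neg_edges H.
Proof.
case=> f [[g fK gK] _ fn]; rewrite /num_neg_edges.
rewrite -(card_imset (mem (neg_edges G)) (imset_inj (can_inj fK))).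
apply: eq_card => e; apply/imsetP/idP => [[e' ee ->]|ee]; first by rewrite fn.
have eE : e = f @: (g @: e).
  by rewrite -imset_comp (eq_imset _ (gK : f \o g =1 id)) imset_id.
by exists (g @: e); rewrite // -fn -eE.
Qed.

Lemma sg_iso_pairsE : sg_iso G H -> exists f : V -> W, [/\ bijective f,
  forall x y, adj H (f x) (f y) = adj G x y
  & forall x y, neg H (f x) (f y) = neg G x y].
Proof.
case=> f [bf fe fn]; exists f; split=> // x y.
  by rewrite {2}/adj /= -fe imsetU1 imset_set1.
by rewrite {2}/neg -fn imsetU1 imset_set1.
Qed.

End Isomorphism.

Section SwitchingEquivalence.

Variables (V W : finType) (G : signed_graph V) (H : signed_graph W).
Hypothesis eqv : switching_equivalent G H.

Lemma switching_equivalent_num_edges : num_edges G = num_edges H.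
Proof. by case: eqv => U /sg_iso_card_edges. Qed.

(** Each vertex of the switching set reverses both of its edges in a triangle, up to edges reversed
    twice. *)
Lemma switching_equivalent_triangle : triangle_positive H -> triangle_positive G.
Proof.
case: eqv => U /sg_iso_pairsE[f [_ fa fn]] tp x y z xy yz zx.
have := tp (f x) (f y) (f z); rewrite !fa !fn !neg_switch xy yz zx.
move=> /(_ xy yz zx); do 3!case: (_ \in U); by do 3!case: (neg _ _ _).
Qed.

(** Switching at [U] adds the indicator function of [U] to a potential. *)
Lemma switching_equivalent_potential p :
  potential G p -> exists q, potential H q.
Proof.
case: eqv => U /sg_iso_pairsE[f [[g fK gK] fa fn]] pp.
exists (fun z => p (g z) (+) (g z \in U)) => z t zt.
rewrite -{1}(gK z) -{1}(gK t) fn neg_switch.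
have gzt : adj G (g z) (g t) by rewrite -[adj G _ _]fa !gK.
rewrite gzt pp //=.
by do 2!case: (_ \in U); do 2!case: (p _).
Qed.

End SwitchingEquivalence.

(** * [Gst] and the negative edges of its switchings *)

Section GstTheory.

Variables s t : nat.

Notation u := (gst_u s t).
Notation v := (gst_v s t).

Lemma mem_gst_us x : (x \in gst_us s t) = if x is inl (inl _) then true else false.
Proof.
apply/imsetP/idP => [[i _ ->]//|]; case: x => [[i|j]|b] // _.
by exists i.
Qed.

Lemma mem_gst_vs x : (x \in gst_vs s t) = if x is inl (inr _) then true else false.
Proof.
apply/imsetP/idP => [[i _ ->]//|]; case: x => [[i|j]|b] // _.
by exists j.
Qed.

Lemma adj_Gst x y : adj (Gst s t) x y =
  match x, y with
  | inl i, inl j => i != j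
  | inl (inl _), inr b | inr b, inl (inl _) => ~~ b
  | inl (inr _), inr b | inr b, inl (inr _) => b
  | inr b, inr b' => b != b'
  end.
Proof.
have us z A : ([set x; y] \in [set [set z; w] | w in A]) =
   (x == z) && (y \in A) || (y == z) && (x \in A).
  apply/imsetP/idP => [[w wA /eqP]|].
    rewrite eq_set2 => /orP[]/andP[/eqP-> /eqP->]; rewrite eqxx wA //=.
    by rewrite orbT.
  case/orP=> /andP[/eqP-> yA]; [by exists y | by exists x; rewrite // setUC].
rewrite /adj /= /gst_edges !in_setU !us !inE eq_set2 cards2 subUset !sub1set !inE.
rewrite !mem_gst_us !mem_gst_vs.
case: x {us} => [[i|j]|[]]; case: y => [[i'|j']|[]] //=;
  by rewrite ?andbF ?orbF ?andbT ?orbT //= eqSS eqb1.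
Qed.

Lemma neg_Gst x y : neg (Gst s t) x y =
  if (x, y) is (inr b, inr b') then b != b' else false.
Proof.
rewrite /neg /= inE eq_set2.
by case: x => [?|[]]; case: y => [?|[]].
Qed.

Lemma Gst_triangle_positive : triangle_positive (Gst s t).
Proof.
move=> x y z; rewrite !adj_Gst !neg_Gst.
by case: x => [[i|j]|[]]; case: y => [[i'|j']|[]]; case: z => [[i''|j'']|[]].
Qed.

Lemma clique_pair_edges_Gst (G : signed_graph (gst_vertex s t)) :
  0 < s -> 0 < t -> edges G = edges (Gst s t) -> clique_pair G u v.
Proof.
move=> s0 t0 EG; have aE : adj G =2 adj (Gst s t) by rewrite /adj EG.
have notuv x : (x \notin [:: u; v]) = if x is inl _ then true else false.
  by rewrite !inE; case: x => [?|[]].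
split.
- by rewrite aE adj_Gst.
- by move=> x; rewrite notuv !aE !adj_Gst; case: x => [[i|j]|[]].
- move=> x y; rewrite !notuv !aE !adj_Gst.
  by case: x => [[?|?]|//]; case: y => [[?|?]|//].
- by exists (gst_ui t (Ordinal s0)); rewrite ?notuv // aE adj_Gst.
- by exists (gst_vj s (Ordinal t0)); rewrite ?notuv // aE adj_Gst.
Qed.

(** The 4-cycle u, v, v_j, u_i has uv as its only negative edge. *)
Lemma Gst_no_potential f : 0 < s -> 0 < t -> ~ potential (Gst s t) f.
Proof.
move=> s0 t0; pose x := gst_ui t (Ordinal s0); pose y := gst_vj s (Ordinal t0).
apply: (@negative_walk_no_potential _ _ [:: u; v; y; x]).
by rewrite /= !adj_Gst !neg_Gst.
Qed.

(** The four families in [gst_edges] are disjoint. The general summand serves both the count of all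
    edges and that of the negative ones. *)
Lemma sum_gst_edges (F : {set gst_vertex s t} -> nat) :
  \sum_(e in gst_edges s t) F e =
  \sum_(e : {set gst_vertex s t}
      | (#|e| == 2) && (e \subset gst_us s t :|: gst_vs s t)) F e
  + \sum_(i < s) F [set u; gst_ui t i] + \sum_(j < t) F [set v; gst_vj s j]
  + F [set u; v].
Proof.
have sumU (A B : {set {set gst_vertex s t}}) : (forall e, e \in A -> e \notin B) ->
    \sum_(e in A :|: B) F e = \sum_(e in A) F e + \sum_(e in B) F e.
  move=> AB; rewrite -bigU /=; first by apply: eq_bigl => e; rewrite !inE.
  by rewrite disjoint_subset; apply/subsetP.
have notK z x : z \notin gst_us s t :|: gst_vs s t ->
    ~~ ([set z; x] \subset gst_us s t :|: gst_vs s t).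
  by apply: contraNN => /subsetP; apply; rewrite !inE eqxx.
have uK : u \notin gst_us s t :|: gst_vs s t by rewrite inE mem_gst_us mem_gst_vs.
have vK : v \notin gst_us s t :|: gst_vs s t by rewrite inE mem_gst_us mem_gst_vs.
rewrite /gst_edges; set P := [set e | _]; set Iu := imset _ _.
set Iv := imset _ (mem (gst_vs s t)).
have PK z x : z \notin gst_us s t :|: gst_vs s t -> [set z; x] \notin P.
  by move=> zK; rewrite inE (negbTE (notK _ _ zK)) andbF.
have d1 e : e \in P -> e \notin Iu.
  by move=> eP; apply/imsetP => -[x _ eE]; rewrite eE (negbTE (PK _ _ uK)) in eP.
have d2 e : e \in P :|: Iu -> e \notin Iv.
  rewrite inE => /orP[eP|/imsetP[_ /imsetP[i _ ->] ->]];
    apply/imsetP => -[_ /imsetP[j _ ->]].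
    by move=> eE; rewrite eE (negbTE (PK _ _ vK)) in eP.
  by move/eqP; rewrite eq_set2.
have d3 e : e \in P :|: Iu :|: Iv -> e \notin [set [set u; v]].
  rewrite [e \in [set _]]inE !in_setU -orbA.
  case/or3P=> [eP|/imsetP[_ /imsetP[i _ ->] ->]|/imsetP[_ /imsetP[i _ ->] ->]].
  - by apply: contraTneq eP => ->; apply: PK.
  - by rewrite eq_set2.
  - by rewrite eq_set2.
rewrite (sumU _ _ d3) (sumU _ _ d2) (sumU _ _ d1) big_set1.
congr (_ + _ + _ + _).
- by apply: eq_bigl => e; rewrite inE.
- rewrite big_imset /=; last first.
    move=> _ _ /imsetP[i _ ->] /imsetP[i' _ ->] /eqP; rewrite eq_set2 eqxx /= ?andbF orbF.
    by move/eqP.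
  by rewrite big_imset // => i i' _ _ [].
- rewrite big_imset /=; last first.
    move=> _ _ /imsetP[i _ ->] /imsetP[i' _ ->] /eqP; rewrite eq_set2 eqxx /= ?andbF orbF.
    by move/eqP.
  by rewrite big_imset // => i i' _ _ [].
Qed.

Lemma card_gst_us : #|gst_us s t| = s.
Proof. by rewrite card_imset ?card_ord // => i j []. Qed.

Lemma card_gst_vs : #|gst_vs s t| = t.
Proof. by rewrite card_imset ?card_ord // => i j []. Qed.

Lemma card_gst_clique : #|gst_us s t :|: gst_vs s t| = s + t.
Proof.
rewrite cardsU disjoint_setI0 ?cards0 ?subn0.
  by rewrite card_gst_us card_gst_vs.
rewrite disjoint_subset; apply/subsetP => x.
by rewrite inE /= mem_gst_us mem_gst_vs; case: x => [[]|].
Qed.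

Lemma card_Gst_edges : num_edges (Gst s t) = 'C(s + t, 2) + (s + t) + 1.
Proof.
rewrite /num_edges /= -sum1_card sum_gst_edges !sum1_card !card_ord.
rewrite -(addnA _ s t) -[in 'C(_, _)]card_gst_clique -cards_draws -sum1_card.
rewrite -sum1_card; congr (_ + _ + 1).
by apply: eq_bigl => e; rewrite inE andbC.
Qed.

Lemma gst_cut_count (U : {set gst_vertex s t}) (z : gst_vertex s t) n
    (g : 'I_n -> gst_vertex s t) (A : {set gst_vertex s t}) :
  injective g -> A = [set g i | i : 'I_n] -> z \notin A ->
  \sum_(i < n) (crosses U [set z; g i] : nat) =
    if z \in U then #|A :\: U| else #|A :&: U|.
Proof.
move=> gi AE zA.
have -> : \sum_(i < n) (crosses U [set z; g i] : nat) =
    \sum_(x in A) ((z \in U) (+) (x \in U) : nat).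
  rewrite AE big_imset /=; last by move=> i j _ _ /gi.
  apply: eq_bigr => i _; rewrite crosses2 //.
  by apply: contraNneq zA => ->; rewrite AE; apply/imsetP; exists i.
rewrite -big_mkcondr /=.
by case: ifP => zU; rewrite -sum1_card; apply: eq_bigl => x; rewrite !inE ?zU // andbC.
Qed.

(** After switching, uv is negative iff it does not cross [U], and every other edge iff it does. The
    summands belong to the clique, the star at u, the star at v, and uv. *)
Lemma card_neg_switch_Gst (U : {set gst_vertex s t}) :
  num_neg_edges (switch U (Gst s t)) =
    let a := #|gst_us s t :&: U| in let b := #|gst_vs s t :&: U| in
    (a + b) * (s + t - (a + b)) + (if u \in U then s - a else a)
    + (if v \in U then t - b else b) + ((u \in U) == (v \in U)).
Proof.
have KI : #|(gst_us s t :|: gst_vs s t) :&: U| =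
    #|gst_us s t :&: U| + #|gst_vs s t :&: U|.
  rewrite setIUl cardsU.
  suff -> : gst_us s t :&: U :&: (gst_vs s t :&: U) = set0 by rewrite cards0 subn0.
  apply/setP => x; rewrite !inE mem_gst_us mem_gst_vs.
  by case: x => [[?|?]|?]; rewrite ?andbF.
rewrite /num_neg_edges /= /switch_neg -sum1_card.
rewrite (eq_bigl (fun e => (e \in gst_edges s t) &&
  ((e == [set u; v]) (+) crosses U e))); last first.
  by move=> e; rewrite !inE.
rewrite big_mkcondr /= sum_gst_edges /=.
have D (A : {set gst_vertex s t}) : #|A| - #|A :&: U| = #|A :\: U|.
  by rewrite -(cardsID U A) addKn.
congr (_ + _ + _ + _).
- rewrite -KI -{1}card_gst_clique D -card_cut -sum1_card -big_mkcondr.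
  apply: eq_bigl => e; rewrite !inE -andbA; case: (_ == 2) => //=.
  case eK: (e \subset _) => //=; case: eqP => // eE.
  have := subsetP eK u; rewrite eE !inE eqxx => /(_ isT).
  by rewrite mem_gst_us mem_gst_vs.
- rewrite -[X in X - _]card_gst_us D -(@gst_cut_count U u s (@gst_ui s t)) //; last first.
  + by rewrite mem_gst_us.
  + by move=> i j [].
  by apply: eq_bigr => i _; rewrite eq_set2 /= ?andbF; case: crosses.
- rewrite -[X in X - _]card_gst_vs D -(@gst_cut_count U v t (@gst_vj s t)) //; last first.
  + by rewrite mem_gst_vs.
  + by move=> i j [].
  by apply: eq_bigr => i _; rewrite eq_set2 /= ?andbF; case: crosses.
- by rewrite eqxx crosses2 //; do 2!case: (_ \in U).
Qed.

(** Removes the isomorphism hidden in switching equivalence: positive triangles and the absence of a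
    potential pass to [Gamma], and on the edge set of [Gst] they determine the signs up to
    switching. *)
Lemma switch_Gst_eq (Gamma : signed_graph (gst_vertex s t)) :
  0 < s -> 0 < t -> edges Gamma = edges (Gst s t) ->
  switching_equivalent Gamma (Gst s t) -> exists U, Gamma = switch U (Gst s t).
Proof.
move=> s0 t0 EG eqv.
have tp := switching_equivalent_triangle eqv Gst_triangle_positive.
have [|f fP] := clique_pair_switching tp (clique_pair_edges_Gst s0 t0 EG).
  move=> f /(switching_equivalent_potential eqv)[g]; exact: Gst_no_potential.
exists [set x | f x]; apply: signed_graph_pair_eq => // x y xy.
have xy' : adj (Gst s t) x y by move: xy; rewrite /adj EG.
by rewrite fP // neg_switch xy' !inE /neg /= inE addbC addbA.
Qed.

End GstTheory.

(** The neighbourhoods of u and v partition the clique into parts of sizes s and t. Switching at [f]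
    makes every edge but uv positive, and the enumeration [g] of the vertices is the inverse of the
    isomorphism. *)
Lemma clique_pair_Gst (V : finType) (G : signed_graph V) u v (f : V -> bool) :
  clique_pair G u v ->
  (forall x y, adj G x y ->
    neg G x y = f x (+) f y (+) ([set x; y] == [set u; v])) ->
  exists s t, [/\ 0 < s, 0 < t, s + t = #|V| - 2
                 & switching_equivalent G (Gst s t)].
Proof.
move=> [uv ex cl [p pK up] [q qK vq]] fP.
have uvN : u != v by exact: adj_neq uv.
pose A := [set x | (x \notin [:: u; v]) && adj G u x].
pose B := [set x | (x \notin [:: u; v]) && adj G v x].
have cAB : #|A| + #|B| = #|V| - 2.
  have -> : #|V| = #|~: [set u; v]| + 2.
    by rewrite -(cardsC [set u; v]) cards2 uvN addnC.
  rewrite addnK -(cardsID A (~: _)); congr (_ + _); apply: eq_card => x.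
    by rewrite !inE; case: (x == u); case: (x == v).
  rewrite !inE; case: (boolP (x \in [:: u; v])); rewrite !inE.
    by case/orP=> ->; rewrite ?orbT ?andbF.
  by move=> xK; rewrite xK /= ex ?inE // andbT.
exists #|A|, #|B|; split=> //.
- by rewrite card_gt0; apply/set0Pn; exists p; rewrite inE pK.
- by rewrite card_gt0; apply/set0Pn; exists q; rewrite inE qK.
exists [set x | f x].
pose g (z : gst_vertex #|A| #|B|) : V :=
  match z with
  | inl (inl i) => enum_val i
  | inl (inr j) => enum_val j
  | inr b => if b then v else u
  end.
have gK a : g (inl a) \notin [:: u; v].
  by case: a => i /=; have := enum_valP i; rewrite inE => /andP[].
have gu a : adj G u (g (inl a)) = if a is inl _ then true else false.
  case: a => i /=; have := enum_valP i; rewrite inE => /andP[xK]; first by [].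
  by rewrite ex // => /negbTE.
have gv a : adj G v (g (inl a)) = if a is inl _ then false else true.
  by rewrite ex // gu; case: a.
have guv b : g (inr b) \in [:: u; v] by case: b; rewrite !inE eqxx ?orbT.
have ginj : injective g.
  move=> [a|b] [a'|b'] E; [|by have := gK a; rewrite E guv
    |by have := gK a'; rewrite -E guv|].
  - have := gu a; rewrite E gu; case: a a' E => [i|j] [i'|j'] //= E _.
      by rewrite (enum_val_inj E).
    by rewrite (enum_val_inj E).
  - case: b b' E => -[] //= E; move: uvN; rewrite E eqxx //.
have gadj z w : adj G (g z) (g w) = adj (Gst #|A| #|B|) z w.
  rewrite adj_Gst; case: z w => [a|b] [a'|b'].
  - have -> : adj G (g (inl a)) (g (inl a')) = (g (inl a) != g (inl a')).
      by apply/idP/idP; [exact: adj_neq|apply: cl].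
    by rewrite (inj_eq ginj); case: a a' => [i|j] [i'|j'].
  - by rewrite adjC; case: b'; rewrite /= ?gu ?gv; case: a.
  - by case: b; rewrite /= ?gu ?gv; case: a'.
  - by case: b b' => -[]; rewrite /= ?adjxx // adjC.
have gneg z w : neg (switch [set x | f x] G) (g z) (g w) = neg (Gst #|A| #|B|) z w.
  rewrite neg_switch gadj !inE.
  have [zw|zw] := boolP (adj _ z w); last first.
    by apply/esym/negbTE; apply: contraNN zw => /neg_adj.
  rewrite fP ?gadj // neg_Gst eq_set2.
  have nu a : (g (inl a) == u) = false.
    by have := gK a; rewrite !inE negb_or => /andP[/negbTE].
  have nv a : (g (inl a) == v) = false.
    by have := gK a; rewrite !inE negb_or => /andP[_ /negbTE].
  set E := (_ || _); have <- : E = if (z, w) is (inr b, inr b') then b != b' else false.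
    rewrite /E; case: z w {zw E} => [a|b] [a'|b']; rewrite ?nu ?nv ?andbF //.
    by case: b b' => -[] /=; rewrite ?eqxx ?[v == u]eq_sym ?(negbTE uvN).
  by case: E; do 2!case: (f _).
have [|g' gg' g'g] := inj_card_bij ginj.
  rewrite !card_sum !card_ord card_bool cAB.
  have : #|[set u; v]| <= #|V| by exact: max_card.
  by rewrite cards2 uvN; lia.
apply: (@sg_iso_pairs _ _ _ _ g'); first by exists g.
  by move=> x y; rewrite -gadj !g'g.
by move=> x y; rewrite -gneg !g'g.
Qed.

(** * Maximising the product of two parts *)

Lemma half_uphalf_cases m : exists r, m./2 = r /\
  (m = r + r /\ uphalf m = r \/ m = r + r + 1 /\ uphalf m = r + 1).
Proof.
exists m./2; split=> //; have := odd_double_half m; rewrite uphalf_half -addnn.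
by case: (odd m) => /= mE; [right | left]; lia.
Qed.

(** If d is the gap between the smaller part and r = [m./2], the product is r^2 - d^2 for even [m]
    and r(r+1) - d(d+1) for odd [m], so a maximum forces d = 0. *)
Lemma half_mul_max m k : k <= m ->
  k * (m - k) <= m./2 * uphalf m /\
  (k * (m - k) = m./2 * uphalf m ->
     (k = m./2 /\ m - k = uphalf m) \/ (k = uphalf m /\ m - k = m./2)).
Proof.
move=> /subnKC; move: (m - k) => l lE; rewrite -{}lE.
case: (half_uphalf_cases (k + l)) => r [-> [] [kl ->]]; case: (leqP k r) => kr.
- have [d rE] : exists d, r = k + d by exists (r - k); lia.
  have lE : l = k + d + d by lia.
  by subst l r; split; nia.
- have [d rE] : exists d, r = l + d by exists (r - l); lia.
  have kE : k = l + d + d by lia.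
  by subst k r; split; nia.
- have [d rE] : exists d, r = k + d by exists (r - k); lia.
  have lE : l = k + d + d + 1 by lia.
  by subst l r; split; nia.
- have [d rE] : exists d, r = l + d by exists (r - l); lia.
  have kE : k = l + d + d + 1 by lia.
  by subst k r; split; nia.
Qed.

(** Since k(m - k) + k = k(m + 1 - k), the product bound for [m.+1] reduces the claim to comparing
    [uphalf m + 1] with [m]: equal for m = 2, 3, strictly smaller from m = 4 on. *)
Lemma cut_plus_one_bound m k : 2 <= m -> k <= m ->
  k * (m - k) + k + 1 <= m./2 * uphalf m + m /\
  (4 <= m -> k * (m - k) + k + 1 <> m./2 * uphalf m + m).
Proof.
move=> m2 km; have [le _] := half_mul_max (leqW km).
move: le; rewrite subSn // -[(m.+1)./2]/(uphalf m) -[uphalf m.+1]/(m./2.+1).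
case: (half_uphalf_cases m) => r [-> [] [mE ->]] le; split; nia.
Qed.

(** * Negative edges: the bound and its equality cases *)

Section NegativeEdges.

Variables s t : nat.

Notation u := (gst_u s t).
Notation v := (gst_v s t).
Notation m := (s + t).

Lemma card_neg_Gst_switched : num_neg_edges (Gst_switched s t) = s * t + m.
Proof.
rewrite card_neg_switch_Gst /= !inE eqxx !mem_gst_us /=.
have -> : gst_us s t :&: (v |: gst_us s t) = gst_us s t.
  by apply/setIidPl/subsetUr.
have -> : gst_vs s t :&: (v |: gst_us s t) = set0.
  by apply/setP => x; rewrite !inE mem_gst_vs mem_gst_us; case: x => [[]|].
by rewrite cards0 card_gst_us; lia.
Qed.

Lemma gst_switch_setE (U : {set gst_vertex s t}) : u \notin U -> v \in U ->
  #|gst_us s t :&: U| = s -> #|gst_vs s t :&: U| = 0 -> U = v |: gst_us s t.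
Proof.
move=> uU vU aE /cards0_eq bE.
have /setIidPl/subsetP sU : gst_us s t :&: U = gst_us s t.
  by apply/eqP; rewrite eqEcard subsetIl card_gst_us aE /=.
apply/setP => -[[i|j]|[]]; rewrite !inE mem_gst_us ?vU //=.
- by apply: sU; rewrite mem_gst_us.
- apply/negbTE/negP => jU.
  by have := in_set0 (gst_vj s j); rewrite -bE inE mem_gst_vs jU.
- exact: negbTE.
Qed.

Hypotheses (s0 : 0 < s) (t0 : 0 < t).

(** The second alternative does occur: for m = 2, 3 the bound is also reached with v outside [U]. *)
Lemma card_neg_switch_bound (U : {set gst_vertex s t}) : u \notin U ->
  num_neg_edges (switch U (Gst s t)) <= m./2 * uphalf m + m /\
  (num_neg_edges (switch U (Gst s t)) = m./2 * uphalf m + m ->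
   ((s = m./2 /\ t = uphalf m) \/ (s = uphalf m /\ t = m./2)) /\
     switch U (Gst s t) = Gst_switched s t
   \/ [/\ m < 4, v \notin U & num_neg_edges (switch U (Gst s t)) =
       let k := #|gst_us s t :&: U| + #|gst_vs s t :&: U| in
       k * (m - k) + k + 1]).
Proof.
move=> uU; have aS : #|gst_us s t :&: U| <= s.
  by rewrite -[X in _ <= X](card_gst_us s t) subset_leq_card ?subsetIl.
have bT : #|gst_vs s t :&: U| <= t.
  by rewrite -[X in _ <= X](card_gst_vs s t) subset_leq_card ?subsetIl.
rewrite card_neg_switch_Gst /= (negbTE uU).
have := @gst_switch_setE U uU.
move: #|gst_us s t :&: U| #|gst_vs s t :&: U| aS bT => a b aS bT.
have [le eqm] := @half_mul_max m (a + b) (leq_add aS bT).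
(* With v in [U], uv is positive and the stars at u and v contribute a + (t - b), which reaches m
   only for a = s, b = 0. With v outside [U], the stars and uv contribute a + b + 1. *)
case: (boolP (v \in U)) => vU setE /=.
  split; first by lia.
  move=> E; have [aE bE] : a = s /\ b = 0 by lia.
  left; split; last by rewrite /Gst_switched -setE.
  by move: eqm; rewrite aE bE addn0 addKn; apply; lia.
have [|le1 ne1] := @cut_plus_one_bound m (a + b) _ (leq_add aS bT); first by lia.
split; first by lia.
move=> E; right; split=> //; last by lia.
by rewrite ltnNge; apply/negP => /ne1; lia.
Qed.

End NegativeEdges.

(** For s = t = 1 the graph is a 4-cycle, and each of these switchings leaves exactly one positive
    edge. The quarter turn [r], its inverse [r'] or the half turn carries that edge to uv, the
    positive edge of [Gst_switched]. *)
Lemma C4_sg_iso (U : {set gst_vertex 1 1}) : gst_u 1 1 \notin U -> gst_v 1 1 \notin U ->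
  0 < #|gst_us 1 1 :&: U| + #|gst_vs 1 1 :&: U| ->
  sg_iso (switch U (Gst 1 1)) (Gst_switched 1 1).
Proof.
move=> uU vU.
have I (z : gst_vertex 1 1) : #|[set z] :&: U| = (z \in U).
  have -> : [set z] :&: U = if z \in U then [set z] else set0.
    apply/setP=> w; rewrite !inE; case: ifP; rewrite ?inE; case: eqP => // ->.
      by move->.
    by move->.
  by case: ifP; rewrite ?cards1 ?cards0.
pose x := gst_ui 1 (@ord0 0); pose y := gst_vj 1 (@ord0 0).
have -> : gst_us 1 1 = [set x].
  by apply/setP => -[[i|j]|b]; rewrite mem_gst_us !inE // ?(ord1 i).
have -> : gst_vs 1 1 = [set y].
  by apply/setP => -[[i|j]|b]; rewrite mem_gst_vs !inE // ?(ord1 j).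
rewrite !I => xy.
have [b [c [bc memU]]] : exists b c, (b || c) /\ forall z : gst_vertex 1 1,
    (z \in U) = match z with inl (inl _) => b | inl (inr _) => c | _ => false end.
  exists (x \in U), (y \in U); split; first by move: xy; do 2!case: (_ \in U).
  by case=> [[i|j]|[]]; rewrite ?(ord1 i) ?(ord1 j) ?(negbTE uU) ?(negbTE vU).
pose r (z : gst_vertex 1 1) : gst_vertex 1 1 :=
  match z with
  | inl (inl _) => y | inl (inr _) => gst_v 1 1
  | inr true => gst_u 1 1 | inr false => x
  end.
pose r' (z : gst_vertex 1 1) : gst_vertex 1 1 :=
  match z with
  | inl (inl _) => gst_u 1 1 | inl (inr _) => x
  | inr true => y | inr false => gst_v 1 1
  end.
have rK : cancel r r' by case=> [[i|j]|[]] //=; rewrite ?(ord1 i) ?(ord1 j).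
have rK' : cancel r' r by case=> [[i|j]|[]] //=; rewrite ?(ord1 i) ?(ord1 j).
have memS (z : gst_vertex 1 1) : (z \in gst_v 1 1 |: gst_us 1 1) =
    match z with inl (inl _) | inr true => true | _ => false end.
  by rewrite !inE mem_gst_us; case: z => [[]|[]].
pose f := if b then if c then r \o r else r else r'.
apply: (@sg_iso_pairs _ _ _ _ f).
- rewrite /f; case: b c {f memU} bc => -[] // _; [|by exists r'|by exists r].
  by apply: bij_comp; exists r'.
- move=> z w; rewrite -[adj (switch _ _)]/(adj (Gst 1 1)).
  rewrite -[adj (Gst_switched _ _)]/(adj (Gst 1 1)) /f !adj_Gst.
  case: b c {f memU} bc => -[] // _; case: z => [[i|j]|[]]; case: w => [[i'|j']|[]] //=;
    by rewrite ?(ord1 i) ?(ord1 j) ?(ord1 i') ?(ord1 j').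
move=> z w; rewrite !neg_switch !memS !memU /f !adj_Gst !neg_Gst.
case: b c {f memU} bc => -[] // _; case: z => [[i|j]|[]]; case: w => [[i'|j']|[]] //=;
  by rewrite ?(ord1 i) ?(ord1 j) ?(ord1 i') ?(ord1 j').
Qed.

Theorem theorem1p2 :
  (forall (n : nat) (V : finType) (G : signed_graph V),
     #|V| = n -> connected G -> unbalanced G -> C3neg_free G ->
     num_edges G <= (n * (n - 1)) %/ 2 - (n - 2) /\
     (num_edges G = (n * (n - 1)) %/ 2 - (n - 2) <->
      exists s t : nat,
        [/\ 1 <= s, 1 <= t, s + t = n - 2 &
            switching_equivalent G (Gst s t)]))
  /\
  (forall (n s t : nat), 1 <= s -> 1 <= t -> s + t = n - 2 ->
     forall Gamma : signed_graph (gst_vertex s t),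
       edges Gamma = edges (Gst s t) ->
       switching_equivalent Gamma (Gst s t) ->
       let fl := (n - 2)./2 in
       let ce := uphalf (n - 2) in
       let bound := fl * ce + (n - 2) in
       let st_balanced := (s = fl /\ t = ce) \/ (s = ce /\ t = fl) in
       [/\ num_neg_edges Gamma <= bound,
           (* equality case, up to isomorphism; its "only if" part fails for
              n = 5, whose "if" part is covered by the last conjunct *)
           n <> 5 ->
             (num_neg_edges Gamma = bound <->
              st_balanced /\ sg_iso Gamma (Gst_switched s t)),
           (* for n >= 6 it moreover holds on the nose *)
           6 <= n ->
             (num_neg_edges Gamma = bound <->
              st_balanced /\ Gamma = Gst_switched s t)
         & st_balanced /\ sg_iso Gamma (Gst_switched s t) ->
             num_neg_edges Gamma = bound]).
Proof.
split=> [n V G cV _ unb free|n s t s0 t0 st Gamma EG eqv].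
  have tp := C3neg_free_triangle_positive free.
  have [c0 nc0] := unbalanced_negative_walk unb.
  have [c sc] := shortest_negative_walk_exists nc0.
  have [leN eqN] := shortest_negative_walk_nonedges tp sc.
  have cE := card_nonedges G; rewrite divn2 subn1 -bin2.
  rewrite -{n}cV; split; first by lia.
  have n4 : 4 <= #|V|.
    rewrite (leq_trans (shortest_negative_walk_size tp sc)) //.
    by rewrite -(card_uniqP (shortest_negative_walk_uniq sc)) max_card.
  (* The subtraction in the bound is truncated; it is exact because the non-edges are among all
     pairs. *)
  have n2 : #|V| - 2 <= 'C(#|V|, 2) by rewrite -cE (leq_trans leN) ?leq_addl.
  split=> [E|[s [t [s0 t0 st eqv]]]].
    have [|h [a [b [d [e sq]]]]] := eqN; first by lia.
    have [u [v uvP]] := square_clique_pair tp sq.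
    have [|f fP] := clique_pair_switching tp uvP.
      by move=> f; apply: negative_walk_no_potential sc.1.
    exact: clique_pair_Gst uvP fP.
  rewrite (switching_equivalent_num_edges eqv) card_Gst_edges.
  have -> : #|V| = (s + t).+2 by lia.
  by rewrite !binS bin0 bin1; lia.
move=> fl ce bound bal.
have [U GU] : exists2 U : {set _}, gst_u s t \notin U & Gamma = switch U (Gst s t).
  have [U GU] := switch_Gst_eq s0 t0 EG eqv.
  case: (boolP (gst_u s t \in U)) => uU; last by exists U.
  by exists (~: U); rewrite ?switch_setC // inE uU.
have eq_iso : bal /\ sg_iso Gamma (Gst_switched s t) -> num_neg_edges Gamma = bound.
  case=> bst /sg_iso_card_neg_edges->; rewrite card_neg_Gst_switched st.
  by congr (_ + _); case: bst => -[-> ->]; rewrite // mulnC.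
have refl : sg_iso (Gst_switched s t) (Gst_switched s t).
  by apply: (@sg_iso_pairs _ _ _ _ id) => //; exists id.
move=> GE; have [le eqb] := card_neg_switch_bound s0 t0 GU.
rewrite -GE st -/fl -/ce -/bound in le eqb.
split=> //.
- move=> n5; split=> // E; case: (eqb E) => [[bst ->] // | [m4 vU]].
  rewrite E => /= kE.
  (* m < 4 and n <> 5 leave m = 2, where the bound is 3; k = 0 would give only 1, so [U] meets the
     clique and [C4_sg_iso] applies. *)
  have [s1 t1] : s = 1 /\ t = 1 by lia.
  move: kE; rewrite GE /bal /bound /fl /ce -st.
  clear - s1 t1 GU vU; subst s t => kE; split; first by left.
  apply: C4_sg_iso => //.
  by move: kE; case: (#|_| + #|_|).
- move=> n6; split=> [E|[bst GS]]; last by apply: eq_iso; rewrite GS.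
  by case: (eqb E) => [//|[m4]]; lia.
Qed.
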